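(* Let $\phi$ be a formula in the language of $\mathbf{FPT}$. The following are equivalent: (i) $\phi$ has the flatness property; (ii) $\phi$ is semantically equivalent to a classical formula (a formula built from $p_i,\neg p_i,\bot$ using $\wedge,\otimes$ only); (iii) $\phi$ has the downward closure property and the union closure property.
   Context: Fix propositional variables $p_i$, $i\in\mathbb{N}$. A valuation is a function $s:\mathbb{N}\to\{0,1\}$ (more generally on $N\subseteq\mathbb N$); a team is a set of valuations. Write $s(\vec i)$ for $\langle s(i_1),\dots,s(i_k)\rangle$. Formulas of the full propositional team logic $\mathbf{FPT}$: $\phi::=p_i\mid\neg p_i\mid\mathrm{NE}\mid\bot\mid p_{i_1}\dots p_{i_k}\perp p_{j_1}\dots p_{j_m}\mid{=}(p_{i_1},\dots,p_{i_k},p_j)\mid p_{i_1}\dots p_{i_k}\subseteq p_{j_1}\dots p_{j_k}\mid\phi\wedge\phi\mid\phi\otimes\phi\mid\phi\circledast\phi\mid\phi\vee\phi$. Semantics: $X\models p_i$ iff $s(i)=1$ for all $s\in X$; $X\models\neg p_i$ iff $s(i)=0$ for all $s\in X$; $X\models\bot$ iff $X=\emptyset$; $X\models\mathrm{NE}$ iff $X\neq\emptyset$; $X\models p_{\vec i}\perp p_{\vec j}$ iff for all $s,s'\in X$ there is $s''\in X$ with $s''(\vec i)=s(\vec i)$ and $s''(\vec j)=s'(\vec j)$; $X\models{=}(p_{\vec i},p_j)$ iff for all $s,s'\in X$, $s(\vec i)=s'(\vec i)$ implies $s(j)=s'(j)$; $X\models p_{\vec i}\subseteq p_{\vec j}$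 iff for all $s\in X$ there is $s'\in X$ with $s(\vec i)=s'(\vec j)$; $X\models\phi\wedge\psi$ iff both; $X\models\phi\otimes\psi$ iff $X=Y\cup Z$ for some $Y,Z\subseteq X$ with $Y\models\phi$, $Z\models\psi$; $X\models\phi\circledast\psi$ iff $X=\emptyset$ or $X=Y\cup Z$ for some nonempty $Y,Z$ with $Y\models\phi$, $Z\models\psi$; $X\models\phi\vee\psi$ iff $X\models\phi$ or $X\models\psi$. $\phi\equiv\psi$ means they are satisfied by the same teams. A formula $\phi$ has the flatness property if for all teams $X$: $X\models\phi\iff\{s\}\models\phi$ for all $s\in X$; the downward closure property if $X\models\phi$ and $Y\subseteq X$ imply $Y\models\phi$; the union closure property if whenever $X\models\phi$ for all $X\in\mathcal{X}$ (for any set $\mathcal X$ of teams) then $\bigcup\mathcal{X}\models\phi$. *)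

(* Defs.v *)
From mathcomp Require Import all_boot.
From mathcomp Require Import boolp classical_sets.

Set Implicit Arguments.
Unset Strict Implicit.
Unset Printing Implicit Defensive.

Local Open Scope classical_set_scope.

Definition valuation := nat -> bool.

Definition team := set valuation.

Definition vals (s : valuation) (i : seq nat) : seq bool := [seq s k | k <- i].

(* The sequences of variables in the atoms may be empty; for instance
   [Dep [::] j] is the constancy atom =(p_j). *)
Inductive FPT : Type :=
| Var of nat
| NegVar of nat
| NE
| Bot
| Indep of seq nat & seq nat
| Dep of seq nat & nat
| Incl (k : nat) of k.-tuple nat & k.-tuple nat
| And of FPT & FPT
| Tensor of FPT & FPT
| NeTensor of FPT & FPT
| Or of FPT & FPT.

Fixpoint sat (X : team) (phi : FPT) {struct phi} : Prop :=
  match phi with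
  | Var i => forall s, X s -> s i = true
  | NegVar i => forall s, X s -> s i = false
  | NE => X <> set0
  | Bot => X = set0
  | Indep i j => forall s s', X s -> X s' ->
      exists s'', [/\ X s'', vals s'' i = vals s i & vals s'' j = vals s' j]
  | Dep i j => forall s s', X s -> X s' -> vals s i = vals s' i -> s j = s' j
  | Incl k i j => forall s, X s -> exists s', X s' /\ vals s i = vals s' j
  | And phi1 phi2 => sat X phi1 /\ sat X phi2
  | Tensor phi1 phi2 => exists Y Z : team,
      [/\ Y `<=` X, Z `<=` X, X = Y `|` Z, sat Y phi1 & sat Z phi2]
  | NeTensor phi1 phi2 => X = set0 \/ exists Y Z : team,
      [/\ Y <> set0, Z <> set0, X = Y `|` Z, sat Y phi1 & sat Z phi2]
  | Or phi1 phi2 => sat X phi1 \/ sat X phi2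
  end.

Definition sem_equiv (phi psi : FPT) : Prop :=
  forall X : team, sat X phi <-> sat X psi.

Fixpoint classical (phi : FPT) : bool :=
  match phi with
  | Var _ | NegVar _ | Bot => true
  | And phi1 phi2 | Tensor phi1 phi2 => classical phi1 && classical phi2
  | _ => false
  end.

Definition flat (phi : FPT) : Prop :=
  forall X : team, sat X phi <-> (forall s, X s -> sat [set s] phi).

Definition downward_closed (phi : FPT) : Prop :=
  forall X Y : team, sat X phi -> Y `<=` X -> sat Y phi.

(* The family [XX] may be empty, so this entails [sat set0 phi]. *)
Definition union_closed (phi : FPT) : Prop :=
  forall XX : set team, (forall X, XX X -> sat X phi) ->
    sat (\bigcup_(X in XX) X) phi.

(* Main.v *)
From mathcomp Require Import all_boot.
From mathcomp Require Import boolp classical_sets.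
Require Import Defs.

Set Implicit Arguments.
Unset Strict Implicit.
Unset Printing Implicit Defensive.

Local Open Scope classical_set_scope.

(** Flatness of [phi] says that the teams satisfying [phi] are exactly the
    subsets of one fixed team. Families of this shape are exactly those closed
    under subsets and unions. A classical formula, read as a Boolean formula
    with [Tensor] as disjunction, is satisfied exactly by the subsets of its
    truth set. Conversely, if [phi] is flat then the fixed team consists of the
    valuations [s] with [sat [set s] phi]; by locality it depends only on the
    finitely many variables of [phi], so it is the truth set of a classical
    formula obtained by Shannon expansion. *)

Section Images.
Variables (aT rT : Type) (f : aT -> rT).

Lemma image_setI_preimage (X : set aT) (C : set rT) :
  f @` (X `&` f @^-1` C) = f @` X `&` C.
Proof.
apply/seteqP; split=> [_ [x [Xx Cfx] <-]|_ [[x Xx <-] Cfx]]; last by exists x.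
by split=> //; exact: imageP.
Qed.

Lemma image_eq_setU (A B Y : set aT) : f @` (A `|` B) = f @` Y ->
  exists A' B', [/\ Y = A' `|` B', f @` A = f @` A' & f @` B = f @` B'].
Proof.
rewrite image_setU => fY.
exists (Y `&` f @^-1` (f @` A)), (Y `&` f @^-1` (f @` B)); split.
- by rewrite -setIUr -preimage_setU fY setIidl //; exact: preimage_image.
- by rewrite image_setI_preimage -fY setUK.
- by rewrite image_setI_preimage -fY setIC setKU.
Qed.

Lemma image_eq_set0 (A B : set aT) :
  f @` A = f @` B -> (A = set0 <-> B = set0).
Proof.
move=> fAB; split=> AB0; apply: (@image_set0_set0 _ _ _ f).
  by rewrite -fAB AB0 image_set0.
by rewrite fAB AB0 image_set0.
Qed.

End Images.

Lemma flat_subsetP (phi : FPT) :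
  flat phi <-> exists A : team, forall X, sat X phi <-> X `<=` A.
Proof.
split=> [phi_flat|[A satE] X]; first by exists [set s | sat [set s] phi].
rewrite satE; have sat1E s : sat [set s] phi <-> A s.
  by rewrite satE; split=> [|As _ ->//]; exact.
by split=> XA s /XA/sat1E.
Qed.

Lemma flat_closedP (phi : FPT) :
  flat phi <-> downward_closed phi /\ union_closed phi.
Proof.
split=> [/flat_subsetP[A satE]|[phi_down phi_union] X].
  split=> [X Y /satE XA YX|XX phiXX].
    by apply/satE; exact: subset_trans XA.
  by apply/satE; apply: bigcup_sub => X /phiXX/satE.
split=> [phiX s Xs|phiX]; first by apply: phi_down phiX _ => _ ->.
have -> : X = \bigcup_(Y in [set [set s] | s in X]) Y.
  by rewrite bigcup_image bigcup_imset1 image_id.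
by apply: phi_union => _ [s Xs <-]; exact: phiX.
Qed.

Fixpoint truth_set (psi : FPT) : team :=
  match psi with
  | Var i => [set s | s i = true]
  | NegVar i => [set s | s i = false]
  | And psi1 psi2 => truth_set psi1 `&` truth_set psi2
  | Tensor psi1 psi2 => truth_set psi1 `|` truth_set psi2
  | _ => set0
  end.

Lemma sat_classical (psi : FPT) (X : team) :
  classical psi -> sat X psi <-> X `<=` truth_set psi.
Proof.
elim: psi X => //= [X _|psi1 IH1 psi2 IH2 X|psi1 IH1 psi2 IH2 X].
- by rewrite subset0.
- by case/andP=> c1 c2; rewrite IH1 // IH2 // subsetI.
- case/andP=> c1 c2; split=> [[Y [Z [_ _ -> /IH1 Y1 /IH2 Z2]]]|X12].
    by apply: setUSS; [exact: Y1|exact: Z2].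
  exists (X `&` truth_set psi1), (X `&` truth_set psi2); split.
  + exact: subIsetl.
  + exact: subIsetl.
  + by rewrite -setIUr setIidl.
  + by apply/IH1 => //; exact: subIsetr.
  + by apply/IH2 => //; exact: subIsetr.
Qed.

Lemma classical_flat (psi : FPT) : classical psi -> flat psi.
Proof.
move=> psi_classical; apply/flat_subsetP; exists (truth_set psi) => X.
exact: sat_classical.
Qed.

Lemma sem_equiv_flat (phi psi : FPT) :
  sem_equiv phi psi -> flat psi -> flat phi.
Proof.
move=> phi_psi psi_flat X; rewrite phi_psi psi_flat.
by split=> sat1 s /sat1/phi_psi.
Qed.

Fixpoint vars (phi : FPT) : seq nat :=
  match phi with
  | Var i | NegVar i => [:: i]
  | NE | Bot => [::]
  | Indep i j => i ++ j
  | Dep i j => j :: i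
  | Incl k i j => i ++ j
  | And phi1 phi2 | Tensor phi1 phi2 | NeTensor phi1 phi2 | Or phi1 phi2 =>
      vars phi1 ++ vars phi2
  end.

Lemma eq_vals_subset (l m : seq nat) (s t : valuation) :
  all [in l] m -> vals s l = vals t l -> vals s m = vals t m.
Proof. by move=> /allP ml /eq_in_map st; apply/eq_in_map => i /ml/st. Qed.

Definition restr (l : seq nat) (X : team) : set (seq bool) :=
  [set vals s l | s in X].

Section Locality.
Variable l : seq nat.

Lemma restr_eq_lift (X Y : team) (t : valuation) :
  restr l X = restr l Y -> Y t -> exists2 s, X s & vals s l = vals t l.
Proof.
by move=> XY Yt; have : restr l Y (vals t l) by [exact: imageP]; rewrite -XY.
Qed.

Lemma sat_indep_local (i j : seq nat) (X Y : team) :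
  all [in l] i -> all [in l] j -> restr l X = restr l Y ->
  sat X (Indep i j) -> sat Y (Indep i j).
Proof.
move=> l_i l_j XY phiX t t' /(restr_eq_lift XY)[s Xs st].
move=> /(restr_eq_lift XY)[s' Xs' st'].
have [s'' [Xs'' s''i s''j]] := phiX s s' Xs Xs'.
have [t'' Yt'' t''s''] := restr_eq_lift (esym XY) Xs''.
exists t''; split=> //.
  by rewrite (eq_vals_subset l_i t''s'') s''i (eq_vals_subset l_i st).
by rewrite (eq_vals_subset l_j t''s'') s''j (eq_vals_subset l_j st').
Qed.

Lemma sat_incl_local (k : nat) (i j : k.-tuple nat) (X Y : team) :
  all [in l] i -> all [in l] j -> restr l X = restr l Y ->
  sat X (Incl i j) -> sat Y (Incl i j).
Proof.
move=> l_i l_j XY phiX t /(restr_eq_lift XY)[s Xs st].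
have [s' [Xs' s'j]] := phiX s Xs.
have [t' Yt' t's'] := restr_eq_lift (esym XY) Xs'.
exists t'; split=> //.
by rewrite -(eq_vals_subset l_i st) s'j (eq_vals_subset l_j t's').
Qed.

Lemma sat_local (phi : FPT) (X Y : team) :
  all [in l] (vars phi) -> restr l X = restr l Y -> sat X phi -> sat Y phi.
Proof.
elim: phi X Y => [i|i|||i j|i j|k i j|phi1 IH1 phi2 IH2|phi1 IH1 phi2 IH2
  |phi1 IH1 phi2 IH2|phi1 IH1 phi2 IH2] X Y l_phi XY /=.
- move=> phiX t /(restr_eq_lift XY)[s Xs /(eq_vals_subset l_phi)[<-]].
  exact: phiX.
- move=> phiX t /(restr_eq_lift XY)[s Xs /(eq_vals_subset l_phi)[<-]].
  exact: phiX.
- by move=> X0 /(image_eq_set0 XY).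
- by move/(image_eq_set0 XY).
- move: l_phi; rewrite /= all_cat => /andP[l_i l_j].
  exact: sat_indep_local XY.
- move=> phiX t t' /(restr_eq_lift XY)[s Xs /(eq_vals_subset l_phi)[<- st]].
  move=> /(restr_eq_lift XY)[s' Xs' /(eq_vals_subset l_phi)[<- st']].
  by rewrite -st -st'; exact: phiX.
- move: l_phi; rewrite /= all_cat => /andP[l_i l_j].
  exact: sat_incl_local XY.
all: move: l_phi; rewrite /= all_cat => /andP[/IH1{}IH1 /IH2{}IH2].
- by move=> [/(IH1 _ _ XY) ? /(IH2 _ _ XY)].
- case=> A [B [_ _ XE satA satB]]; rewrite XE in XY.
  have [A' [B' [-> AA' BB']]] := image_eq_setU XY.
  by exists A', B'; split=> //; [exact: IH1 satA|exact: IH2 satB].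
- case=> [/(image_eq_set0 XY)|[A [B [A0 B0 XE satA satB]]]]; first by left.
  rewrite XE in XY; have [A' [B' [-> AA' BB']]] := image_eq_setU XY.
  right; exists A', B'; split=> //.
  + by move/(image_eq_set0 AA').
  + by move/(image_eq_set0 BB').
  + exact: IH1 satA.
  + exact: IH2 satB.
- by case=> [/(IH1 _ _ XY)|/(IH2 _ _ XY)]; [left|right].
Qed.

End Locality.

Lemma truth_set_complete (l : seq nat) (A : team) :
  (forall s t, vals s l = vals t l -> A s -> A t) ->
  exists2 psi, classical psi & truth_set psi = A.
Proof.
elim: l A => [|v l IHl] A A_local.
  have [->|/eqP/set0P[s As]] := pselect (A = set0); first by exists Bot.
  exists (Tensor (Var 0) (NegVar 0)) => //=.
  apply/seteqP; split=> t _; first exact: A_local As.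
  by rewrite /setU /=; case: (t 0); [left|right].
have cofactor b : exists2 psi, classical psi &
    truth_set psi = [set s | A [eta s with v |-> b]].
  apply: IHl => s t /eq_in_map st; apply: A_local.
  apply/eq_in_map => i; rewrite inE /=.
  by case: eqP => //= _; exact: st.
have [[psi1 c1 T1] [psi0 c0 T0]] := conj (cofactor true) (cofactor false).
exists (Tensor (And (Var v) psi1) (And (NegVar v) psi0)).
  by rewrite /= c1 c0.
rewrite /= T1 T0; apply/funext => s.
have {2}-> : s = [eta s with v |-> s v].
  by apply/funext => i /=; case: eqP => // ->.
apply/propext; rewrite /setU /setI /=.
by case: (s v); split=> [[[]|[]]|] //; [left|right].
Qed.

Lemma flat_equiv_classical (phi : FPT) : flat phi ->
  exists2 psi, classical psi & sem_equiv phi psi.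
Proof.
move=> phi_flat.
have [s t st|psi c psiE] :=
  @truth_set_complete (vars phi) [set s | sat [set s] phi].
  by apply: (sat_local (allss _)); rewrite /restr !image_set1 st.
by exists psi => // X; rewrite phi_flat sat_classical // psiE.
Qed.

Theorem theorem3p2 (phi : FPT) :
  (flat phi <-> exists psi : FPT, classical psi = true /\ sem_equiv phi psi) /\
  ((exists psi : FPT, classical psi = true /\ sem_equiv phi psi) <->
   (downward_closed phi /\ union_closed phi)).
Proof.
have flatE : flat phi <->
    exists psi : FPT, classical psi = true /\ sem_equiv phi psi.
  split=> [/flat_equiv_classical[psi]|[psi [/classical_flat psi_flat phi_psi]]].
    by exists psi.
  exact: sem_equiv_flat psi_flat.
by split=> //; rewrite -flatE; exact: flat_closedP.
Qed.
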